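(* Let $R$ be a unital associative ring, $M$ a nonzero left $R$-module, $\Omega = \mathbb{Z}^+$, $N = \bigoplus_{\alpha\in\Omega} M_\alpha$ with each $M_\alpha = M$, and $E = \mathrm{End}_R(N)$. Suppose that $M$ is finitely generated and $\mathrm{End}_R(M)$ is a simple ring. If $S\subseteq E$ is a subring that is closed in the function topology and satisfies $D\subseteq S$, then exactly one of the following holds: (1) $S\approx D$; (2) $S\approx E$.
   Context: $\mathbb{Z}^+$ is the set of positive integers. Endomorphisms are written on the right of their arguments, so $x(fg)=(xf)g$. Each $M_\alpha$ is identified with the corresponding summand of $N$. $D\subseteq E$ is the subring of all $f\in E$ such that $M_\alpha f\subseteq M_\alpha$ for each $\alpha\in\Omega$. The function topology on $E$ is the topology inherited from the set $N^N$ of all functions $N\to N$, where a subbasis of open sets is given by the sets $\{f\in N^N : mf=n\}$ for all $m,n\in N$. For subrings $S_1,S_2\subseteq E$, $S_1\approx S_2$ means that there are finite subsets $U,U'\subseteq E$ such that $S_1\subseteq\langle S_2\cup U\rangle$ and $S_2\subseteq\langle S_1\cup U'\rangle$, where $\langle X\rangle$ is the subring generated by $X$ (equivalently, $\langle S_1\cup U\rangle=\langle S_2\cup U\rangle$ for some finite $U\subseteq E$). *)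

(* Defs.v *)
From HB Require Import structures.
From mathcomp Require Import all_boot all_algebra.
From mathcomp Require Import all_classical topology.

Set Implicit Arguments.
Unset Strict Implicit.
Unset Printing Implicit Defensive.

Import GRing.Theory.
Local Open Scope classical_set_scope.
Local Open Scope ring_scope.

Section Ring.
Context {A : pzRingType}.

Definition subring (S : set A) : Prop := subring_closed [in S].

Definition gen_subring (X : set A) : set A := smallest subring X.

Definition fin_equiv (S1 S2 : set A) : Prop :=
  exists U U' : set A, [/\ finite_set U, finite_set U',
    S1 `<=` gen_subring (S2 `|` U) & S2 `<=` gen_subring (S1 `|` U')].

Definition two_sided_ideal (J : set A) : Prop :=
  zmod_closed [in J] /\ forall a x : A, J x -> J (a * x) /\ J (x * a).

End Ring.

Definition simple_ring (A : pzRingType) : Prop :=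
  (1 : A) <> 0 /\
  forall J : set A, two_sided_ideal J -> J = [set 0] \/ J = setT.

Definition fin_gen (R : pzRingType) (M : lmodType R) : Prop :=
  exists (n : nat) (g : 'I_n -> M),
    forall m : M, exists c : 'I_n -> R, m = \sum_(i < n) c i *: g i.

(* An alias of [N -> N] carrying the function topology, i.e. pointwise
   convergence with [N] discrete. *)
Definition fun_space (N : Type) : Type := N -> N.

Section FunSpace.
Variable N : Type.

HB.instance Definition _ := gen_eqMixin (fun_space N).
HB.instance Definition _ := gen_choiceMixin (fun_space N).

Definition fun_subbase : set (set (fun_space N)) :=
  [set B | exists m n : N, B = [set f : fun_space N | f m = n]].

HB.instance Definition _ :=
  isSubBaseTopological.Build (fun_space N) fun_subbase id.

End FunSpace.

Definition endo (R : pzRingType) (M : lmodType R) : Type := {linear M -> M}.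

Section Endo.
Variables (R : pzRingType) (M : lmodType R).
Implicit Types f g h : endo M.

HB.instance Definition _ := gen_eqMixin (endo M).
HB.instance Definition _ := gen_choiceMixin (endo M).

Lemma endoP f g : f =1 g -> f = g.
Proof.
case: f g => [f [[f1] [f2]]] [g [[g1] [g2]]] /= /funext fg.
by subst g; congr GRing.Linear.Pack; congr GRing.Linear.Class;
  [congr GRing.isNmodMorphism.Axioms_|congr GRing.isScalable.Axioms_];
  exact: Prop_irrelevance.
Qed.

Definition endo_zero : endo M := \0.
Definition endo_one : endo M := idfun.
Definition endo_opp f : endo M := \- f.
Definition endo_add f g : endo M := f \+ g.
(* Endomorphisms act on the right, so the product [f * g] applies [f] first. *)
Definition endo_mul f g : endo M := g \o f.

Fact endo_addA : associative endo_add.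
Proof. by move=> f g h; apply: endoP => x /=; rewrite addrA. Qed.
Fact endo_addC : commutative endo_add.
Proof. by move=> f g; apply: endoP => x /=; rewrite addrC. Qed.
Fact endo_add0 : left_id endo_zero endo_add.
Proof. by move=> f; apply: endoP => x /=; rewrite add0r. Qed.
Fact endo_addN : left_inverse endo_zero endo_opp endo_add.
Proof. by move=> f; apply: endoP => x /=; rewrite addNr. Qed.
Fact endo_mulA : associative endo_mul.
Proof. by move=> f g h; apply: endoP. Qed.
Fact endo_mul1 : left_id endo_one endo_mul.
Proof. by move=> f; apply: endoP. Qed.
Fact endo_mulr1 : right_id endo_one endo_mul.
Proof. by move=> f; apply: endoP. Qed.
Fact endo_mulDl : left_distributive endo_mul endo_add.
Proof. by move=> f g h; apply: endoP => x /=; rewrite raddfD. Qed.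
Fact endo_mulDr : right_distributive endo_mul endo_add.
Proof. by move=> f g h; apply: endoP. Qed.

HB.instance Definition _ := GRing.isPzRing.Build (endo M)
  endo_addA endo_addC endo_add0 endo_addN
  endo_mulA endo_mul1 endo_mulr1 endo_mulDl endo_mulDr.

Definition endo_fun f : fun_space M := f.

HB.instance Definition _ :=
  Topological.copy (endo M) (initial_topology endo_fun).

End Endo.

Section DirectSum.
Variables (I : choiceType) (R : pzRingType) (M : lmodType R).

Definition fin_supp : {pred (I -> M)} :=
  fun x => `[< finite_set [set i | x i != 0] >].

Record dsum := DSum { dsum_val :> I -> M; _ : dsum_val \in fin_supp }.

HB.instance Definition _ := [isSub for dsum_val].
HB.instance Definition _ := [Choice of dsum by <:].

Fact fin_supp_submod : submod_closed fin_supp.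
Proof.
split=> [|a x y /asboolP xfin /asboolP yfin]; apply/asboolP.
  by apply: sub_finite_set (finite_set0 I) => i /=; rewrite eqxx.
apply: (@sub_finite_set _ _ ([set i | x i != 0] `|` [set i | y i != 0])).
  move=> i /=; have [xi0|] := eqVneq (x i) 0; last by left.
  have [yi0|] := eqVneq (y i) 0; last by right.
  by rewrite !fctE /= xi0 yi0 scaler0 addr0 eqxx.
by rewrite finite_setU.
Qed.

HB.instance Definition _ := GRing.SubChoice_isSubLmodule.Build R (I -> M)
  fin_supp dsum (GRing.submod_closed_semi fin_supp_submod).

Fact fin_supp_inj (i : I) (m : M) :
  (fun j => if j == i then m else 0) \in fin_supp.
Proof.
apply/asboolP; apply: sub_finite_set (finite_set1 i) => j /=.
by have [->//|_] := eqVneq j i; rewrite eqxx.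
Qed.

Definition dsum_inj (i : I) (m : M) : dsum := DSum (fin_supp_inj i m).

Definition summand (i : I) : set dsum := range (dsum_inj i).

Definition diag_endo : set (endo dsum) :=
  [set f | forall i, f @` summand i `<=` summand i].

End DirectSum.

Arguments diag_endo : clear implicits.
Arguments diag_endo I {R} M.

Definition pos_int : Type := {n : nat | (0 < n)%N}.
HB.instance Definition _ := Countable.on pos_int.

(* Main.v *)
From HB Require Import structures.
Require Import Defs.
From mathcomp Require Import finmap.
From mathcomp Require Import all_boot all_algebra.
From mathcomp Require Import all_classical topology.

Set Implicit Arguments.
Unset Strict Implicit.
Unset Printing Implicit Defensive.

Import GRing.Theory.
Local Open Scope classical_set_scope.
Local Open Scope ring_scope.

(** Write [e_i] for the projection of [N] onto the [i]-th summand.  An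
    endomorphism [f] of [N] is a matrix with entries [f_ij] in [End(M)]; since
    [M] is finitely generated, every row of this matrix is finite, and [E] is
    the ring of all row-finite matrices, in which [D] is the ring of diagonal
    ones.

    The whole information in [S] is the relation [reach]: [j] is reachable
    from [i] when some [f] in [S] has [f_ij <> 0].  Since [D] is contained in
    [S], the [k] such that the matrix with single entry [k] at [(i, j)] lies
    in [S] form a two-sided ideal of [End(M)], so by simplicity a reachable
    position can be filled arbitrarily ([full_entries]).  Closedness then
    passes from finitely many rows to infinitely many, so that [S] is the set
    of all endomorphisms supported on [reach] ([closed_reach_mem]).  What
    decides between the two cases is whether infinitely many indices [i] have
    an infinite set [reach i].

    - If only finitely many do, [S] is generated by [D] and four more elements
      ([finite_reach_equiv]).  Spread row [i] over copies [b i j] of the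
      reachable [j], with [b] injective on pairs, apply the diagonal
      endomorphism with entry [f_ij] at [b i j], and send [b i j] back to [j]:
      this is a factorization [P * d * Q] of [f] with [P] and [Q] independent
      of [f].  The finitely many exceptional rows are finite sums of single
      entries, which can be written with [D], the map sending every summand
      onto a fixed one, and a shift.

    - If infinitely many do, [E] is contained in [P * S * Q] for two fixed
      relabellings [P] and [Q] ([infinite_reach_equiv]).  [P] moves each row to
      an index [c i] with infinite reach, and the sets [reach (c i)] contain
      pairwise distinct representatives [b (c i) j]; an element of [S] can
      place the [j]-th entry of a row at [b (c i) j], and [Q] moves it back to
      [j].

    The two cases exclude each other because [E] is not generated by [D]
    together with a finite set ([diag_not_full]): this is a growth argument.
    If [h] bounds how far the rows of the finitely many added elements
    extend, the rows of any generated element are bounded by an iterate of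
    [h], and a diagonal construction outgrows all iterates. *)

(** * Finitely generated extensions of subrings *)

Section Subrings.
Context {A : pzRingType}.
Implicit Types (S X Y Z U V : set A) (x y : A).

Lemma subringP S : subring S <->
  [/\ S 1, forall x y, S x -> S y -> S (x - y)
         & forall x y, S x -> S y -> S (x * y)].
Proof.
split=> [[]|[S1 SB SM]].
  rewrite inE => S1 SB SM; split=> // x y Sx Sy.
    by have := SB x y; rewrite !inE; apply.
  by have := SM x y; rewrite !inE; apply.
split; first by rewrite inE.
  by move=> x y; rewrite !inE; apply: SB.
by move=> x y; rewrite !inE; apply: SM.
Qed.

Section Closure.
Variables (S : set A) (S_subring : subring S).

Lemma subring1 : S 1.
Proof. by have /subringP[] := S_subring. Qed.

Lemma subringB x y : S x -> S y -> S (x - y).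
Proof. by have /subringP[_ SB _] := S_subring; apply: SB. Qed.

Lemma subringM x y : S x -> S y -> S (x * y).
Proof. by have /subringP[_ _ SM] := S_subring; apply: SM. Qed.

Lemma subring0 : S 0.
Proof. by rewrite -(subrr 1); apply: subringB subring1 subring1. Qed.

Lemma subringD x y : S x -> S y -> S (x + y).
Proof.
move=> Sx Sy; rewrite -[y]opprK -[- y]sub0r; apply: subringB => //.
exact: subringB subring0 Sy.
Qed.

Lemma subring_sum (I : eqType) (s : seq I) (F : I -> A) :
  (forall i, i \in s -> S (F i)) -> S (\sum_(i <- s) F i).
Proof.
move=> SF; rewrite big_seq; apply: big_ind => //.
  exact: subring0.
exact: subringD.
Qed.

Lemma subringX x n : S x -> S (x ^+ n).
Proof.
move=> Sx; elim: n => [|n IHn]; first exact: subring1.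
by rewrite exprS; exact: subringM.
Qed.

End Closure.

Lemma gen_subring_subring X : subring (gen_subring X).
Proof.
apply/subringP; split=> [T [Tring _]|x y Sx Sy T TX|x y Sx Sy T TX].
- exact: subring1.
- by apply: (subringB TX.1); [apply: Sx|apply: Sy].
- by apply: (subringM TX.1); [apply: Sx|apply: Sy].
Qed.

Lemma sub_gen_subring X : X `<=` gen_subring X.
Proof. exact: sub_gen_smallest. Qed.

Lemma gen_subring_min X S : subring S -> X `<=` S -> gen_subring X `<=` S.
Proof. exact: smallest_sub. Qed.

(** Transitivity of the relation of being contained in a finitely generated
    extension: it reduces the incompatibility of the two alternatives to the
    single fact that [E] does not lie in a finite extension of [D]. *)
Lemma gen_subring_trans X Y Z U V :
  X `<=` gen_subring (Y `|` U) -> Y `<=` gen_subring (Z `|` V) ->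
  X `<=` gen_subring (Z `|` (U `|` V)).
Proof.
move=> XYU YZV; apply: subset_trans XYU _; apply: gen_subring_min.
  exact: gen_subring_subring.
move=> x [/YZV|Ux]; last by apply: sub_gen_subring; right; left.
apply: gen_subring_min x; first exact: gen_subring_subring.
by move=> x [Zx|Vx]; apply: sub_gen_subring; [left|right; right].
Qed.

Lemma fin_equiv_extension X Y U :
  X `<=` Y -> finite_set U -> Y `<=` gen_subring (X `|` U) -> fin_equiv X Y.
Proof.
move=> XY Ufin YXU; exists set0, U; split=> //.
by move=> x /XY Yx; apply: sub_gen_subring; left.
Qed.

Lemma fin_equivC X Y : fin_equiv X Y -> fin_equiv Y X.
Proof. by move=> [U [U' [? ? ? ?]]]; exists U', U. Qed.

End Subrings.

(** * Endomorphisms of a direct sum as row-finite matrices *)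

Section DirectSums.
Variables (I : choiceType) (R : pzRingType) (M : lmodType R).
Local Notation N := (dsum I M).
Local Notation E := (endo N).
Implicit Types (i j : I) (m : M) (x y : N) (f g : E) (k : endo M).

Lemma dsumP x y : (forall i, x i = y i) -> x = y.
Proof. by move=> xy; apply/val_inj/funext. Qed.

Lemma dsum_injE i m j : dsum_inj i m j = if j == i then m else 0.
Proof. by []. Qed.

Fact dsum_inj_linear i : linear (@dsum_inj I R M i).
Proof.
move=> a m n; apply: dsumP => j.
rewrite [RHS]/= !fctE /= [RHS]/=.
by case: eqP => _ //; rewrite scaler0 addr0.
Qed.
HB.instance Definition _ i :=
  GRing.isLinear.Build R M N _ (@dsum_inj I R M i) (dsum_inj_linear i).

Definition coord j x : M := x j.
Fact coord_linear j : linear (coord j).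
Proof. by []. Qed.
HB.instance Definition _ j :=
  GRing.isLinear.Build R N M _ (coord j) (coord_linear j).

Lemma dsum_sumE (J : Type) (s : seq J) (F : J -> N) j :
  (\sum_(t <- s) F t) j = \sum_(t <- s) F t j.
Proof. exact: (raddf_sum (coord j)). Qed.

Lemma dsum_supp_finite x : finite_set [set i | x i != 0].
Proof. by have /asboolP := valP x. Qed.

Definition supp x : {fset I} := fset_set [set i | x i != 0].

Lemma mem_supp x i : (i \in supp x) = (x i != 0).
Proof.
rewrite in_fset_set; last exact: dsum_supp_finite.
by apply/idP/idP; rewrite inE.
Qed.

Lemma dsum_decomp (s : seq I) x :
  uniq s -> (forall i, x i != 0 -> i \in s) ->
  \sum_(i <- s) dsum_inj i (x i) = x.
Proof.
move=> s_uniq xs; apply: dsumP => j; rewrite dsum_sumE.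
have [js|js] := boolP (j \in s).
  rewrite (bigD1_seq j) //= eqxx big1 ?addr0 // => i ij.
  by rewrite eq_sym (negPf ij).
have -> : x j = 0 by apply: contraNeq js; exact: xs.
rewrite big_seq big1 // => i is_; rewrite dsum_injE.
by case: eqP => // ji; rewrite ji is_ in js.
Qed.

Lemma dsum_supp_decomp x : \sum_(i <- supp x) dsum_inj i (x i) = x.
Proof. by apply: dsum_decomp => // i; rewrite mem_supp. Qed.

Lemma dsum_decomp0 (s : seq I) i m :
  i \notin s -> \sum_(j <- s) dsum_inj j (dsum_inj i m j) = 0.
Proof.
move=> si; rewrite big_seq big1 // => j js; rewrite dsum_injE.
by case: eqP => [ji|_]; [rewrite -ji js in si|rewrite raddf0].
Qed.

Lemma endo_eq f g : (forall i m, f (dsum_inj i m) = g (dsum_inj i m)) -> f = g.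
Proof.
move=> fg; apply: endoP => x.
rewrite -(dsum_supp_decomp x).
by rewrite !raddf_sum; apply: eq_bigr => i _; apply: fg.
Qed.

Lemma endo_sumE (J : Type) (s : seq J) (F : J -> E) x :
  (\sum_(t <- s) F t) x = \sum_(t <- s) F t x.
Proof. exact: (big_morph (fun f : E => f x)). Qed.

(** The universal property of the direct sum.  The sum has infinite range, but
    for each [x] only finitely many terms are nonzero. *)
Definition dsum_lift (phi : I -> {linear M -> N}) x : N :=
  \sum_(i \in [set: I]) phi i (x i).

Lemma dsum_liftE phi x (s : seq I) :
  uniq s -> (forall i, x i != 0 -> i \in s) ->
  dsum_lift phi x = \sum_(i <- s) phi i (x i).
Proof.
move=> s_uniq xs; rewrite /dsum_lift (fsbigE s) // => [|i _ si].
  by apply: eq_bigl => i; rewrite in_setT.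
by rewrite (_ : x i = 0) ?raddf0 //; apply: contraNeq si; exact: xs.
Qed.

Fact dsum_lift_linear phi : linear (dsum_lift phi).
Proof.
move=> a x y; pose s : {fset I} := (supp x `|` supp y)%fset.
rewrite !(@dsum_liftE phi _ s) ?fset_uniq //; first last.
- move=> i; rewrite /s inE !mem_supp; apply: contraNT.
  move=> /norP[/negPn/eqP xi /negPn/eqP yi].
  by rewrite [_ i](_ : _ = a *: x i + y i) // xi yi scaler0 addr0.
- by move=> i xi; rewrite /s inE mem_supp xi.
- by move=> i yi; rewrite /s inE !mem_supp yi orbT.
rewrite scaler_sumr -big_split /=; apply: eq_bigr => i _.
exact: (linearP (phi i)).
Qed.
HB.instance Definition _ phi :=
  GRing.isLinear.Build R N N _ (dsum_lift phi) (dsum_lift_linear phi).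

Definition endo_lift phi : E := dsum_lift phi.

Lemma endo_lift_inj phi i m : endo_lift phi (dsum_inj i m) = phi i m.
Proof.
rewrite /endo_lift /= (@dsum_liftE _ _ [:: i]) ?big_seq1 ?dsum_injE ?eqxx //.
move=> j.
by rewrite dsum_injE inE; have [//|_] := eqVneq j i; rewrite eqxx.
Qed.

Definition entry f i j : endo M := coord j \o (f \o dsum_inj i).
Definition unit_endo i j k : E := dsum_inj j \o (k \o coord i).
Definition diag (c : I -> endo M) : E := endo_lift (fun i => dsum_inj i \o c i).
Definition relabel (a : I -> I) : E := endo_lift (fun i => dsum_inj (a i)).

Lemma diag_inj c i m : diag c (dsum_inj i m) = dsum_inj i (c i m).
Proof. exact: endo_lift_inj. Qed.

Lemma relabel_inj a i m : relabel a (dsum_inj i m) = dsum_inj (a i) m.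
Proof. exact: endo_lift_inj. Qed.

Lemma unit_endo_inj i j k m : unit_endo i j k (dsum_inj i m) = dsum_inj j (k m).
Proof. by rewrite /unit_endo /= /coord eqxx. Qed.

Lemma unit_endo_inj0 i j k i' m :
  i' != i -> unit_endo i j k (dsum_inj i' m) = 0.
Proof.
move=> i'i; rewrite /unit_endo /= /coord eq_sym (negPf i'i).
by rewrite !raddf0.
Qed.

Lemma diag_mem c : diag_endo I M (diag c).
Proof. by move=> i _ [_ [m _ <-] <-]; exists (c i m); rewrite ?diag_inj. Qed.

Lemma unit_endo_diag i k : diag_endo I M (unit_endo i i k).
Proof.
move=> i' _ [_ [m _ <-] <-].
have [->|i'i] := eqVneq i' i; first by exists (k m); rewrite ?unit_endo_inj.
by exists 0; rewrite ?unit_endo_inj0 // raddf0.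
Qed.

Lemma diag_endo_entry f i j m :
  diag_endo I M f -> f (dsum_inj i m) j != 0 -> j = i.
Proof.
move=> fD; have [n _ <-] : summand i (f (dsum_inj i m)).
  by apply: fD; exists (dsum_inj i m) => //; exists m.
by rewrite dsum_injE; have [//|_] := eqVneq j i; rewrite eqxx.
Qed.

Lemma unit_endo_entry f i j :
  unit_endo i i 1 * f * unit_endo j j 1 = unit_endo i j (entry f i j).
Proof. by apply: endoP. Qed.

Definition row_supp f i : set I := [set j | exists m, f (dsum_inj i m) j != 0].

(** The images of finitely many generators of the [i]-th summand involve only
    finitely many summands, and they determine the whole row. *)
Lemma row_supp_finite f i : fin_gen M -> finite_set (row_supp f i).
Proof.
move=> [n [g gM]].
apply: (@sub_finite_set _ _
  (\bigcup_(t in [set: 'I_n]) [set j | f (dsum_inj i (g t)) j != 0])).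
  move=> j [m]; have [c ->] := gM m => /eqP fj.
  apply: contrapT => gj0; apply: fj.
  rewrite -[f _]/((f \o dsum_inj i) _) linear_sum dsum_sumE big1 // => t _.
  rewrite linearZ [LHS](_ : _ = c t *: f (dsum_inj i (g t)) j) //.
  have [->|gj] := eqVneq (f (dsum_inj i (g t)) j) 0; first exact: scaler0.
  by case: gj0; exists t.
apply: bigcup_finite => // t _; exact: dsum_supp_finite.
Qed.

Definition reach (S : set E) i : set I := \bigcup_(f in S) row_supp f i.

(** The sum of [e_i * f] over [i] in [s] is [f] with all rows outside [s]
    replaced by zero.  As the remaining rows are finite, it is a finite sum of
    single entries. *)
Lemma finite_rows_mem (S : set E) f (s : seq I) :
  fin_gen M -> subring S ->
  (forall i j, i \in s -> S (unit_endo i j (entry f i j))) ->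
  S (\sum_(i <- s) unit_endo i i 1 * f).
Proof.
move=> M_fg S_ring Sf; apply: subring_sum => // i si.
pose J := fset_set (row_supp f i).
have -> : unit_endo i i 1 * f = \sum_(j <- J) unit_endo i j (entry f i j).
  apply: endoP => x; rewrite endo_sumE.
  rewrite -[LHS](@dsum_decomp J) ?fset_uniq // => j fxj.
  rewrite in_fset_set; last exact: row_supp_finite.
  by rewrite inE; exists (x i).
by apply: subring_sum => // j _; apply: Sf.
Qed.

Lemma finite_rows_inj f (s : seq I) i m : uniq s ->
  (\sum_(j <- s) unit_endo j j 1 * f) (dsum_inj i m) =
  if i \in s then f (dsum_inj i m) else 0.
Proof.
move=> s_uniq; rewrite endo_sumE.
have -> : \sum_(j <- s) (unit_endo j j 1 * f) (dsum_inj i m) =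
          f (\sum_(j <- s) dsum_inj j (dsum_inj i m j)).
  by rewrite raddf_sum.
case: ifPn => si; last by rewrite dsum_decomp0 // raddf0.
rewrite dsum_decomp // => j; rewrite dsum_injE.
by have [->//|_] := eqVneq j i; rewrite eqxx.
Qed.

Lemma finite_rows_supp f (s : seq I) x : uniq s ->
  (forall i, x i != 0 -> i \in s) ->
  (\sum_(j <- s) unit_endo j j 1 * f) x = f x.
Proof.
move=> s_uniq xs; rewrite endo_sumE -[in RHS](dsum_decomp s_uniq xs).
by rewrite raddf_sum.
Qed.

(** Multiplying by single diagonal entries on both sides shows that the
    coefficients allowed in [S] at position [(i, j)] form a two-sided ideal; a
    nonzero [f_ij] is one of them, so simplicity gives them all. *)
Lemma full_entries (S : set E) i j k :
  simple_ring (endo M) -> subring S -> diag_endo I M `<=` S ->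
  reach S i j -> S (unit_endo i j k).
Proof.
move=> [_ simpleM] S_ring DS [f Sf [m fij]].
pose J := [set k | S (unit_endo i j k)].
have J_ideal : two_sided_ideal J.
  split.
    split; first rewrite inE.
      have -> : J 0 = S 0.
        congr (S _); apply: endoP => x; exact: raddf0.
      exact: subring0.
    move=> k1 k2; rewrite !inE => Jk1 Jk2.
    have -> : J (k1 - k2) = S (unit_endo i j k1 - unit_endo i j k2).
      congr (S _); apply: endoP => x; exact: (raddfB (dsum_inj j)).
    exact: subringB.
  move=> a k0 Jk0; split.
    have -> : J (a * k0) = S (unit_endo i i a * unit_endo i j k0).
      congr (S _); apply: endoP => x /=; rewrite /coord /=.
      by rewrite eqxx.
    by apply: subringM => //; apply: DS; exact: unit_endo_diag.
  have -> : J (k0 * a) = S (unit_endo i j k0 * unit_endo j j a).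
    congr (S _); apply: endoP => x /=; rewrite /coord /=.
    by rewrite eqxx.
  by apply: subringM => //; apply: DS; exact: unit_endo_diag.
have [J0|JT] := simpleM _ J_ideal; last by have : J k by rewrite JT.
have : J (entry f i j).
  rewrite /J /= -unit_endo_entry.
  by do 2?[apply: subringM => //]; apply: DS; exact: unit_endo_diag.
rewrite J0 => /(congr1 (fun h : endo M => h m)) fij0.
by move: fij; rewrite [f _ _]fij0 eqxx.
Qed.

(** The basic neighbourhoods of [f] prescribe its values at finitely many
    points, so membership in a closed set can be tested by interpolation. *)
Lemma closed_endo_mem (S : set E) f : closed S ->
  (forall s : seq N, exists2 g, S g & {in s, g =1 f}) -> S f.
Proof.
move=> S_closed fS; apply: contrapT => nSf.
have [B Bop BS] : open (~` S) by rewrite openC.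
have [C Cbase CB] : exists2 C : set (set (fun_space N)),
    C `<=` finI_from (@fun_subbase N) id & \bigcup_(W in C) W = B by exact: Bop.
have : (~` S) f by [].
rewrite -BS /preimage /= -CB => -[W CW Wf].
have [F FD FW] := Cbase _ CW.
have F_eval (V : set (fun_space N)) : V \in F ->
    exists x y, V = [set h : fun_space N | h x = y].
  by move=> /FD; rewrite inE.
(* Each of the finitely many subbasic sets in [F] constrains one point. *)
pose pt V := xget 0 [set x | exists y, V = [set h : fun_space N | h x = y]].
have [g Sg gf] := fS (map pt F).
suff : (~` S) g by [].
rewrite -BS /preimage /= -CB; exists W => //.
rewrite -FW => V FV; have /F_eval := FV.
move=> /xgetPex-/(_ 0) [y Vy].
have : V (endo_fun f) by move: Wf; rewrite -FW; apply.
rewrite Vy /= => <-; apply: gf.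
exact: map_f.
Qed.


(** Given finitely many points of [N], cutting [f] down to the finitely many
    rows in their supports does not change its values there, and the result
    lies in [S] because all its entries do. *)
Lemma closed_reach_mem (S : set E) f :
  fin_gen M -> simple_ring (endo M) -> subring S -> diag_endo I M `<=` S ->
  closed S -> (forall i, row_supp f i `<=` reach S i) -> S f.
Proof.
move=> M_fg M_simple S_ring DS S_closed f_reach.
apply: closed_endo_mem => // X.
pose s := undup (flatten [seq (supp x : seq I) | x <- X]).
have s_uniq : uniq s by exact: undup_uniq.
exists (\sum_(i <- s) unit_endo i i 1 * f); last first.
  move=> x Xx; apply: finite_rows_supp => // i xi; rewrite mem_undup.
  by apply/flatten_mapP; exists x => //; rewrite mem_supp.
apply: finite_rows_mem => // i j _.
have [ij|ij] := pselect (row_supp f i j).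
  by apply: full_entries => //; exact: f_reach.
have -> : unit_endo i j (entry f i j) = 0; last exact: subring0.
apply: endoP => x; rewrite /unit_endo /= /entry /= /coord.
have -> : f (dsum_inj i (x i)) j = 0; last exact: raddf0.
by apply: contrapT => /eqP fij; apply: ij; exists (x i).
Qed.

Lemma relabel_supp a x j : relabel a x j != 0 -> exists i, a i = j.
Proof.
move=> /eqP axj; apply: contrapT => aj; apply: axj.
rewrite -(dsum_supp_decomp x) linear_sum dsum_sumE big1 // => i _.
rewrite relabel_inj dsum_injE; have [ji|//] := eqVneq j (a i).
by case: aj; exists i.
Qed.

Lemma relabelX a n i m :
  (relabel a ^+ n) (dsum_inj i m) = dsum_inj (iter n a i) m.
Proof.
elim: n i => [//|n IHn] i; rewrite iterSr -IHn exprS.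
by rewrite -(relabel_inj a).
Qed.

Definition spread (s : seq I) m : N := \sum_(j <- s) dsum_inj j m.

Fact spread_linear s : linear (spread s).
Proof.
move=> a m n; rewrite /spread scaler_sumr -big_split /=.
by apply: eq_bigr => j _; exact: (linearP (dsum_inj j)).
Qed.
HB.instance Definition _ s :=
  GRing.isLinear.Build R M N _ (spread s) (spread_linear s).

End DirectSums.

(** * Representatives in infinite families of infinite sets *)

Section CountableIndices.
Variables (I : countType) (I_infinite : infinite_set [set: I]).

(** Greedy choice along an enumeration of [K]: an infinite set always contains
    a point different from the finitely many chosen before. *)
Lemma distinct_representatives (K : countType) (A : K -> set I) :
  (forall p, infinite_set (A p)) ->
  exists2 c : K -> I, injective c & forall p, A p (c p).
Proof.
move=> A_inf.
(* Numbers that code no element of [K] get a dummy set. *)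
pose A' n := if unpickle n is Some p then A p else setT.
have pickA n (l : seq I) : exists i, A' n i /\ i \notin l.
  have [i [Ai il]] : A' n `\` [set` l] !=set0.
    apply/infinite_setN0/infinite_setD; last exact: finite_seq.
    by rewrite /A'; case: unpickle.
  by exists i; split=> //; apply/negP.
pose next n l := sval (cid (pickA n l)).
pose prior := fix prior n :=
  if n is n'.+1 then next n' (prior n') :: prior n' else [::].
pose c n := next n (prior n).
have c_prior m n : (m < n)%N -> c m \in prior n.
  elim: n => // n IHn; rewrite ltnS leq_eqVlt inE.
  by case/orP=> [/eqP ->|/IHn ->]; rewrite ?eqxx ?orbT.
have c_notin n : c n \notin prior n by rewrite /c /next; case: cid => i [].
have c_inj : injective c.
  move=> m n cmn; have [/c_prior|/c_prior|//] := ltngtP m n.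
    by rewrite cmn (negPf (c_notin n)).
  by rewrite -cmn (negPf (c_notin m)).
exists (c \o pickle) => [|p]; first exact: inj_comp c_inj (pcan_inj pickleK).
have : A' (pickle p) (c (pickle p)) by rewrite /c /next; case: cid => i [].
by rewrite /A' pickleK.
Qed.

(** With [A] constantly the full set, [b] is an injective coding of pairs of
    indices by indices.  The left inverses [q1] and [q2] are what makes the
    coding undoable by a relabelling of the summands. *)
Lemma pair_representatives (A : I -> set I) :
  (forall i, infinite_set (A i)) ->
  exists (b : I -> I -> I) (q1 q2 : I -> I),
    [/\ forall i j, A i (b i j), forall i j, q1 (b i j) = i
      & forall i j, q2 (b i j) = j].
Proof.
move=> A_inf.
have [c c_inj cA] :=
  @distinct_representatives _ (A \o @fst I I) (fun p => A_inf p.1).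
have [i0 _] := infinite_setN0 I_infinite.
have /choice[q qP] : forall y, exists p, forall p', c p' = y -> p' = p.
  move=> y; have [[p <-]|noc] := pselect (exists p, c p = y).
    by exists p => p' /c_inj.
  by exists (i0, i0) => p' cp'; case: noc; exists p'.
have cK p : q (c p) = p by apply/esym/qP.
exists (fun i j => c (i, j)), (fst \o q), (snd \o q).
by split=> i j /=; [exact: cA (i, j)|rewrite cK|rewrite cK].
Qed.

Lemma pickle_unbounded n : exists i : I, (n < pickle i)%N.
Proof.
apply: contrapT => nI; apply: I_infinite.
apply: (@sub_finite_set _ _ (@pickle I @^-1` `I_n.+1)).
  by move=> i _ /=; rewrite ltnS leqNgt; apply/negP => ni; apply: nI; exists i.
apply: finite_preimage; last exact: finite_II.
by move=> i j _ _; exact: (pcan_inj pickleK).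
Qed.

(** Along such an [a], powers of one relabelling reach all summands from a
    single one. *)
Lemma single_orbit :
  exists (a : I -> I) (i0 : I), forall j, exists n, iter n a i0 = j.
Proof.
have [rk [_ rk_inj rk_surj]] : exists f, set_bij [set: I] [set: nat] f.
  exact/card_set_bijP/eq_card_nat/I_infinite/countableP.
have /choice[ix ixK] n : exists i, rk i = n.
  by have [i _ <-] := rk_surj n Logic.I; exists i.
exists (fun i => ix (rk i).+1), (ix 0%N) => j; exists (rk j).
have -> : iter (rk j) (fun i => ix (rk i).+1) (ix 0%N) = ix (rk j).
  by elim: (rk j) => //= n ->; rewrite ixK.
by apply: rk_inj; rewrite ?inE.
Qed.

(** * Growth of rows *)

Variables (R : pzRingType) (M : lmodType R) (M_fin_gen : fin_gen M).
Local Notation N := (dsum I M).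
Local Notation E := (endo N).
Local Notation D := (diag_endo I M).
Implicit Types (i j : I) (m : M) (f g : E) (h : nat -> nat) (S : set E).

Definition row_bound h f :=
  forall i j, row_supp f i j -> (pickle j <= h (pickle i))%N.

Definition growth h := {homo h : m n / (m <= n)%N} /\ forall n, (n <= h n)%N.

Lemma growth_iter h L : growth h -> growth (iter L h).
Proof.
move=> [h_homo h_ge]; elim: L => [|L [IHhomo IHge]]; first by split.
split=> [m n mn|n] /=; first exact/h_homo/IHhomo.
exact: leq_trans (IHge n) (h_ge _).
Qed.

Lemma leq_growth_iter h L L' n :
  growth h -> (L <= L')%N -> (iter L h n <= iter L' h n)%N.
Proof.
by move=> hg /subnK <-; rewrite iterD; apply: (growth_iter _ hg).2.
Qed.

Lemma row_bound_exists f : exists2 h, growth h & row_bound h f.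
Proof.
have /choice[h1 h1P] :
    forall i, exists n, forall j, row_supp f i j -> (pickle j <= n)%N.
  move=> i; exists (\max_(j <- fset_set (row_supp f i)) pickle j) => j fij.
  apply: (leq_bigmax_seq (F := pickle)) => //.
  by rewrite in_fset_set ?inE //; exact: row_supp_finite.
pose h0 k := if unpickle k is Some i then h1 i else 0%N.
exists (fun n => n + \sum_(k < n.+1) h0 k)%N.
  split=> [m n mn|n]; last exact: leq_addr.
  apply: leq_add => //.
  rewrite -!(big_mkord xpredT h0) [leqRHS](big_cat_nat (n := m.+1)) //=.
  exact: leq_addr.
move=> i j /h1P /leq_trans; apply; rewrite big_ord_recr /= {2}/h0 pickleK.
by rewrite addnA leq_addl.
Qed.

Lemma row_bound_finite (U : set E) :
  finite_set U -> exists2 h, growth h & forall f, U f -> row_bound h f.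
Proof.
move=> /finite_seqP[s ->]; elim: s => [|f s [h [h_homo h_ge] hs]].
  by exists id; first by split.
have [h' [h'_homo h'_ge] h'f] := row_bound_exists f.
exists (fun n => h n + h' n)%N.
  split=> [m n mn|n]; first by apply: leq_add; [exact: h_homo|exact: h'_homo].
  exact: leq_trans (h_ge n) (leq_addr _ _).
move=> g /=; rewrite inE => /orP[/eqP ->|gs] i j gij.
  exact: leq_trans (h'f _ _ gij) (leq_addl _ _).
exact: leq_trans (hs _ gs _ _ gij) (leq_addr _ _).
Qed.

Lemma row_suppB f g i : row_supp (f - g) i `<=` row_supp f i `|` row_supp g i.
Proof.
move=> j [m fgj].
have [f0|f0] := eqVneq (f (dsum_inj i m) j) 0; last by left; exists m.
have [g0|g0] := eqVneq (g (dsum_inj i m) j) 0; last by right; exists m.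
move: fgj; rewrite [_ j](_ : _ = f (dsum_inj i m) j - g (dsum_inj i m) j) //.
by rewrite f0 g0 subrr eqxx.
Qed.

Lemma row_suppM f g i :
  row_supp (f * g) i `<=` \bigcup_(l in row_supp f i) row_supp g l.
Proof.
move=> j [m /eqP fgj]; apply: contrapT => nj; apply: fgj.
pose x := f (dsum_inj i m).
rewrite [_ j](_ : _ = g x j) //.
rewrite -(dsum_supp_decomp x) raddf_sum dsum_sumE big_seq big1 // => l.
rewrite mem_supp => xl.
apply: contrapT => /eqP glj; apply: nj; exists l; first by exists m.
by exists (x l).
Qed.

(** The elements whose rows are bounded by some iterate of [h] form a subring:
    a difference needs the larger of the two exponents, a product their sum.
    Diagonal elements are bounded by the zeroth iterate. *)
Lemma diag_not_full (U : set E) :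
  (exists m : M, m <> 0) -> finite_set U ->
  ~ ([set: E] `<=` gen_subring (D `|` U)).
Proof.
move=> [m0 m0_neq0] /row_bound_finite[h h_growth hU] full.
pose T := [set f : E | exists L, row_bound (iter L h) f].
have T_ring : subring T.
  apply/subringP; split.
  - exists 0%N => i j [m]; rewrite dsum_injE.
    by have [->//|_] := eqVneq j i; rewrite eqxx.
  - move=> f g [L fL] [L' gL']; exists (maxn L L') => i j /row_suppB[/fL|/gL'];
      move=> /leq_trans; apply; apply: leq_growth_iter => //.
      exact: leq_maxl.
    exact: leq_maxr.
  - move=> f g [L fL] [L' gL']; exists (L' + L)%N => i j.
    move=> /row_suppM[l /fL il /gL' lj].
    rewrite iterD; apply: leq_trans lj _.
    exact: (growth_iter L' h_growth).1.
have DUT : D `|` U `<=` T.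
  move=> f [fD|/hU Uf]; last by exists 1%N.
  by exists 0%N => i j [m /(diag_endo_entry fD) ->].
(* Row [i] of [relabel M a] exceeds the iterate of order [pickle i], hence the
   iterates of all orders up to [pickle i]. *)
have /choice[a aP] i := pickle_unbounded (iter (pickle i) h (pickle i)).
have [L aL] : T (relabel M a).
  by apply: (gen_subring_min T_ring DUT); exact: full.
have [i Li] := pickle_unbounded L.
have /aL : row_supp (relabel M a) i (a i).
  by exists m0; rewrite relabel_inj dsum_injE eqxx; apply/eqP.
rewrite leqNgt => /negP; apply; apply: leq_ltn_trans (aP i).
exact/leq_growth_iter/ltnW.
Qed.

(** * The two cases *)

(** Here [f = P * d * Q] on the rows with finite reach, where only the diagonal
    endomorphism [d] depends on [f]. *)
Lemma finite_reach_equiv S :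
  finite_set [set i | infinite_set (reach S i)] ->
  exists2 U : set E, finite_set U & S `<=` gen_subring (D `|` U).
Proof.
move=> F_finite; pose F := fset_set [set i | infinite_set (reach S i)].
have [b [q1 [q2 [_ q1b q2b]]]] := pair_representatives (fun=> I_infinite).
have [a [i0 orbit_a]] := single_orbit.
(* [fset_set] is empty on an infinite set, so [P] vanishes on the rows in
   [F]. *)
pose P : E :=
  endo_lift (fun i => spread [seq b i j | j <- fset_set (reach S i)]).
pose Q : E := relabel M q2.
pose Z : E := relabel M (fun=> i0).
pose A : E := relabel M a.
exists [set P; Q; Z; A]; first by rewrite !finite_setU.
move=> f Sf; set G := gen_subring _.
have G_ring : subring G by exact: gen_subring_subring.
have DG g : D g -> G g by move=> Dg; apply: sub_gen_subring; left.
have [GP GQ GZ GA] : [/\ G P, G Q, G Z & G A].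
  by split; apply: sub_gen_subring; right; rewrite /=; tauto.
(* A single entry: collapse to [i0], shift to [j], and apply [k] there. *)
have G_unit i j k : G (unit_endo i j k).
  have [n jE] := orbit_a j.
  have -> : unit_endo i j k = unit_endo i i 1 * Z * A ^+ n * unit_endo j j k.
    apply: endoP => x.
    transitivity (unit_endo j j k ((A ^+ n) (Z (dsum_inj i (x i))))) => //.
    by rewrite relabel_inj relabelX jE unit_endo_inj.
  apply: (subringM G_ring) => //; last by apply: DG; apply: unit_endo_diag.
  apply: (subringM G_ring) => //; last exact: (subringX G_ring).
  by apply: (subringM G_ring) => //; by apply: DG; apply: unit_endo_diag.
pose d := diag (fun p => entry f (q1 p) (q2 p)).
have -> : f = \sum_(i <- F) unit_endo i i 1 * f + P * d * Q.
  apply: endo_eq => i m.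
  rewrite [RHS](_ : _ = (\sum_(i <- F) unit_endo i i 1 * f) (dsum_inj i m) +
    Q (d (P (dsum_inj i m)))) //.
  rewrite finite_rows_inj ?fset_uniq // endo_lift_inj /= /spread big_map.
  have -> : Q (d (\sum_(j <- fset_set (reach S i)) dsum_inj (b i j) m)) =
      \sum_(j <- fset_set (reach S i)) dsum_inj j (f (dsum_inj i m) j).
    rewrite (linear_sum d) (linear_sum Q); apply: eq_bigr => j _.
    by rewrite diag_inj relabel_inj q1b q2b.
  rewrite in_fset_set //.
  have [i_inf|/contrapT i_fin] := pselect (infinite_set (reach S i)).
    rewrite mem_set // /fset_set; case: pselect => // _.
    by rewrite big_nil addr0.
  rewrite memNset // add0r dsum_decomp ?fset_uniq // => j fij.
  by rewrite in_fset_set //; apply/mem_set; exists f => //; exists m.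
apply: (subringD G_ring) => //; first by apply: finite_rows_mem.
by do 2!apply: (subringM G_ring) => //; by apply: DG; apply: diag_mem.
Qed.

(** Here [f = P * s * Q] with [s] in [S]: row [c i i0] of [s] is row [i] of [f]
    with its [j]-th entry placed at [b (c i i0) j], which is reachable. *)
Lemma infinite_reach_equiv S :
  simple_ring (endo M) -> subring S -> D `<=` S -> closed S ->
  infinite_set [set i | infinite_set (reach S i)] ->
  exists2 U : set E, finite_set U & [set: E] `<=` gen_subring (S `|` U).
Proof.
move=> M_simple S_ring DS S_closed F_infinite.
(* Where [reach] is finite, any infinite set may replace it, since [P] only
   uses rows with infinite reach. *)
pose A i := if `[< infinite_set (reach S i) >] then reach S i else setT.
have A_inf i : infinite_set (A i) by rewrite /A; case: asboolP.
have [b [_ [q2 [bA _ q2b]]]] := pair_representatives A_inf.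
have [c [q [_ [cF qc _]]]] := pair_representatives (fun=> F_infinite).
have [i0 _] := infinite_setN0 I_infinite.
pose P : E := relabel M (c^~ i0).
pose Q : E := relabel M q2.
exists [set P; Q]; first exact: finite_set2.
move=> f _; set G := gen_subring _.
have G_ring : subring G by exact: gen_subring_subring.
pose s : E := endo_lift (fun i : I =>
  (if `[< infinite_set (reach S i) >]
   then relabel M (b i) \o (f \o dsum_inj (q i)) : {linear M -> N}
   else \0 : {linear M -> N})).
have Ss : S s.
  apply: closed_reach_mem => // i j [m]; rewrite endo_lift_inj.
  case: asboolP => [i_inf|_]; last by rewrite /= eqxx.
  move=> /relabel_supp[j' <-]; have := bA i j'; rewrite /A.
  by case: asboolP.
have -> : f = P * s * Q.
  apply: endo_eq => i m.
  rewrite [RHS](_ : _ = Q (s (P (dsum_inj i m)))) // relabel_inj endo_lift_inj.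
  case: asboolP => [_|]; last by case; exact: cF.
  rewrite /= qc.
  have bQ : relabel M (b (c i i0)) * Q = 1.
    apply: endo_eq => l n.
    rewrite [LHS](_ : _ = Q (relabel M (b (c i i0)) (dsum_inj l n))) //.
    by rewrite !relabel_inj q2b.
  transitivity ((relabel M (b (c i i0)) * Q) (f (dsum_inj i m))) => //.
  by rewrite bQ.
apply: (subringM G_ring) => //; last by apply: sub_gen_subring; right; right.
by apply: (subringM G_ring) => //; apply: sub_gen_subring; [right; left|left].
Qed.

End CountableIndices.

Lemma pos_int_infinite : infinite_set [set: pos_int].
Proof.
pose succ n : pos_int := exist _ n.+1 (ltn0Sn n).
move=> /(@finite_preimage _ _ _ succ) fin_nat; apply: infinite_nat.
by rewrite -(preimage_setT succ); apply: fin_nat => m n _ _ [].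
Qed.

Theorem corollary24 (R : pzRingType) (M : lmodType R)
    (M_neq0 : exists m : M, m <> 0)
    (M_fin_gen : fin_gen M)
    (M_simple : simple_ring (endo M))
    (S : set (endo (dsum pos_int M)))
    (S_subring : subring S) (S_closed : closed S)
    (D_sub_S : diag_endo pos_int M `<=` S) :
  (fin_equiv S (diag_endo pos_int M) /\ ~ fin_equiv S setT) \/
  (~ fin_equiv S (diag_endo pos_int M) /\ fin_equiv S setT).
Proof.

have I_inf := pos_int_infinite.
have not_full U := diag_not_full I_inf M_fin_gen (U := U) M_neq0.
have [F_fin|F_inf] := pselect (finite_set [set i | infinite_set (reach S i)]).
  have [U Ufin SDU] := finite_reach_equiv I_inf M_fin_gen F_fin.
  left; split; first by apply: fin_equivC; exact: fin_equiv_extension Ufin SDU.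
  move=> [_ [U' [_ U'fin _ ESU']]].
  apply: (not_full _ _ (gen_subring_trans ESU' SDU)).
  by rewrite finite_setU.
have [U Ufin ESU] :=
  infinite_reach_equiv I_inf M_fin_gen M_simple S_subring D_sub_S S_closed
    F_inf.
right; split; last exact: fin_equiv_extension Ufin ESU.
move=> [U' [_ [U'fin _ SDU' _]]].
apply: (not_full _ _ (gen_subring_trans ESU SDU')).
by rewrite finite_setU.
Qed.
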